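(* Let $X,Y$ be locally compact Hausdorff spaces and let $G\colon X\times Y\to[0,+\infty]$ be a lower semicontinuous kernel. Suppose $0<q<+\infty$, $\sigma\in\mathcal{M}^+(X)$, and let $C>0$ be a constant. Then $$\|\mathbf{G}\nu\|_{L^{q,\infty}(X,\sigma)}\le C\,\|\nu\|\quad\text{for all }\nu\in\mathcal{M}^+(Y)$$ if and only if $$\sigma(K)\le C^q\,\bigl(\operatorname{cap}_0(K)\bigr)^q\quad\text{for all compact sets }K\subset X,$$ with the same constant $C$ in both statements.
   Context: $\mathcal{M}^+(X)$ denotes the nonnegative, locally finite Borel (Radon) measures on $X$ (similarly for $Y$); for $K\subset X$ compact, $\mathcal{M}^+(K)$ denotes those supported in $K$; $\|\nu\|=\nu(Y)$ for $\nu\in\mathcal{M}^+(Y)$. $\mathbf{G}\nu(x)=\int_Y G(x,y)\,d\nu(y)$ for $x\in X$, and $\mathbf{G}^*\mu(y)=\int_X G(x,y)\,d\mu(x)$ for $y\in Y$. $\|f\|_{L^{q,\infty}(X,\sigma)}=\sup_{t>0}t\,\sigma(\{|f|>t\})^{1/q}$. For compact $K\subset X$, $$\operatorname{cap}_0(K)=\sup\{\mu(K)\colon\mu\in\mathcal{M}^+(K),\ \mathbf{G}^*\mu(y)\le1\text{ for all }y\in Y\}.$$ *)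

(* Defs.v *)
From HB Require Import structures.
From mathcomp Require Import all_boot all_order all_algebra.
From mathcomp Require Import all_classical all_reals all_analysis.

Set Implicit Arguments.
Unset Strict Implicit.
Unset Printing Implicit Defensive.

Import Order.TTheory GRing.Theory Num.Theory.
Import numFieldNormedType.Exports.

Local Open Scope classical_set_scope.
Local Open Scope ring_scope.
Local Open Scope ereal_scope.

(* [measurableType] requires a pointed carrier, hence the use of
   [ptopologicalType], i.e. nonempty topological spaces, throughout. *)
Notation borel T := (g_sigma_algebraType (@open T)).

Section radon.
Context {R : realType} {T : ptopologicalType}.
Implicit Type mu : {measure set (borel T) -> \bar R}.

Definition locally_finite mu :=
  forall x : T, exists U : set T, [/\ open U, U x & mu U < +oo].

Definition outer_regular mu :=
  forall A : set (borel T), measurable A ->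
    mu A = ereal_inf [set mu U | U in [set U : set T | open U /\ A `<=` U]].

Definition inner_regular_open mu :=
  forall U : set T, open U ->
    mu U = ereal_sup [set mu K | K in [set K : set T | compact K /\ K `<=` U]].

(* Inner regularity is required on open sets only (and then follows on the
   Borel sets of sigma-finite measure): on a locally compact Hausdorff space
   these are exactly the measures given by the Riesz representation theorem for
   positive linear functionals on compactly supported continuous functions. *)
Definition radon mu :=
  [/\ locally_finite mu, outer_regular mu & inner_regular_open mu].

(* In a Hausdorff space a compact [K] is closed, so its complement is Borel. *)
Definition supported_in (K : set T) mu := mu (~` K) = 0.

End radon.

Definition weak_Lnorm {R : realType} {T : ptopologicalType}
    (sigma : {measure set (borel T) -> \bar R}) (q : R) (f : T -> \bar R)
    : \bar R :=
  ereal_sup [set t%:E * sigma [set x | t%:E < `|f x|] `^ q^-1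
            | t in [set t : R | (0 < t)%R]].

Section potentials.
Context {R : realType} {X Y : ptopologicalType}.
Variable G : X * Y -> \bar R.

Definition potential (nu : {measure set (borel Y) -> \bar R}) (x : X)
    : \bar R :=
  \int[nu]_y G (x, y).

Definition adjoint_potential (mu : {measure set (borel X) -> \bar R}) (y : Y)
    : \bar R :=
  \int[mu]_x G (x, y).

Definition cap0 (K : set X) : \bar R :=
  ereal_sup [set mu K | mu in [set mu : {measure set (borel X) -> \bar R} |
    [/\ radon mu, supported_in K mu
      & forall y : Y, adjoint_potential mu y <= 1]]].

End potentials.

(* Main.v *)
Require Import Defs.
From HB Require Import structures.
From mathcomp Require Import all_boot all_order all_algebra.
From mathcomp Require Import all_classical all_reals all_analysis.
From mathcomp Require Import measurable_realfun ring.

(* From capacity to weak type: if t < G nu on a compact K and G^* mu <= 1, then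
   t mu(K) <= nu(Y).  No Fubini theorem for lower semicontinuous kernels is
   needed: by inner regularity of nu and lower semicontinuity of G, near each x
   in K the kernel dominates a fixed function h on Y with nu-integral above t;
   finitely many such h, glued over a finite cover of K, suffice.  Hence
   cap_0(K) <= nu(Y)/t for every compact K inside the open set {G nu > t}, and
   inner regularity of sigma concludes.

   From weak type to capacity: for nu a finite combination of Dirac masses, the
   weak-type bound leaves a definite part of sigma(K) where G nu <= t0 nu(Y), so
   sigma restricted to that part and normalized is a probability measure, with
   sigma-density bounded independently of nu, under which G nu has mean at most
   t0 nu(Y).  A minimax argument, finite-dimensional approachability followed by
   compactness, exchanges the quantifiers and yields one probability mu on K with
   bounded density and G^* mu <= t on Y.  Bounded density is the point: a setwise
   ultrafilter limit of such measures is automatically a Radon measure, so no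
   Riesz representation is needed. *)

Set Implicit Arguments.
Unset Strict Implicit.
Unset Printing Implicit Defensive.

Import Order.TTheory GRing.Theory Num.Theory.
Import numFieldNormedType.Exports.
Import HBNNSimple.

Local Open Scope classical_set_scope.
Local Open Scope ring_scope.
Local Open Scope ereal_scope.

(** * Regularity of Radon measures *)

Lemma open_borel {T : ptopologicalType} (A : set T) :
  open A -> measurable (A : set (borel T)).
Proof. exact: sub_sigma_algebra. Qed.

Lemma closed_borel {T : ptopologicalType} (A : set T) :
  closed A -> measurable (A : set (borel T)).
Proof.
move=> cA; rewrite -[A]setCK.
by apply: (@measurableC _ (borel T)); apply: open_borel; exact: closed_openC.
Qed.

Lemma compact_borel {T : ptopologicalType} (A : set T) :
  hausdorff_space T -> compact A -> measurable (A : set (borel T)).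
Proof. by move=> hT cA; apply: closed_borel; exact: compact_closed. Qed.

Lemma lsc_borel {R : realType} {T : ptopologicalType} (f : T -> \bar R) :
  lower_semicontinuous f -> measurable_fun [set: borel T] (f : borel T -> \bar R).
Proof.
move=> lf; apply: (measurability _ (ErealGenOInfty.measurableE R)).
move=> _ [_ [a ->] <-]; rewrite setTI preimage_itvoy.
by apply: open_borel; move/lower_semicontinuousP : lf; exact.
Qed.

Section inner_regularity.
Context {R : realType} {T : ptopologicalType}.
Variable mu : {measure set (borel T) -> \bar R}.
Hypothesis hT : hausdorff_space T.
Hypothesis mu_radon : radon mu.

Lemma inner_regular_open_lt (U : set T) (e : R) : open U -> mu U < +oo ->
  (0 < e)%R -> exists2 K, compact K /\ K `<=` U & mu (U `\` K) <= e%:E.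
Proof.
case: mu_radon => _ _ ir oU Ufin e0.
have Ufn : mu U \is a fin_num by rewrite ge0_fin_numE.
have : mu U - e%:E < ereal_sup
    [set mu K | K in [set K : set T | compact K /\ K `<=` U]].
  by rewrite -ir// lteBlDr// lteDl// lte_fin.
case/ereal_sup_gt => _ [K [cK KU] <-] ltK; exists K => //.
rewrite measureD; [|exact: open_borel|exact: compact_borel|by []].
rewrite (setIidr KU) leeBlDl; last first.
  rewrite ge0_fin_numE//; apply: le_lt_trans Ufin; apply: le_measure => //.
  - by rewrite inE; exact: compact_borel.
  - by rewrite inE; exact: open_borel.
by rewrite -leeBlDr//; exact: ltW.
Qed.

Lemma outer_regular_lt (A : set (borel T)) (e : R) : measurable A ->
  mu A < +oo -> (0 < e)%R ->
  exists2 U, open U /\ A `<=` U & mu (U `\` A) <= e%:E.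
Proof.
case: mu_radon => _ outer _ mA Afin e0.
have Afn : mu A \is a fin_num by rewrite ge0_fin_numE.
have : ereal_inf [set mu U | U in [set U : set T | open U /\ A `<=` U]] <
    mu A + e%:E.
  by rewrite -outer// lteDl// lte_fin.
case/ereal_inf_lt => _ [U [oU AU] <-] ltU; exists U => //.
rewrite measureD; [|exact: open_borel|by []|]; last first.
  by apply: lt_trans ltU _; rewrite ltey_eq fin_numD Afn.
by rewrite (setIidr AU) leeBlDl//; exact: ltW.
Qed.

(** Finite mass lets outer regularity of [~]
    A[stand in for inner regularity of]A[: from a compact]L[carrying almost all the mass, remove an
    open]V[that barely exceeds]~[A]. *)
Lemma inner_regular_borel_lt (A : set (borel T)) (e : R) :
  mu setT < +oo -> measurable A -> (0 < e)%R ->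
  exists2 K, compact K /\ K `<=` A & mu (A `\` K) <= e%:E.
Proof.
move=> Tfin mA e0; have e20 : (0 < e / 2)%R by rewrite divr_gt0.
have fin (B : set (borel T)) : measurable B -> mu B < +oo.
  by move=> mB; apply: le_lt_trans Tfin; apply: le_measure; rewrite ?inE.
have [V [oV AV] ltV] : exists2 V, open V /\ ~` A `<=` V &
    mu (V `\` ~` A) <= (e / 2)%:E.
  by apply: outer_regular_lt => //; [exact: measurableC|apply: fin; exact: measurableC].
have [L [cL _] ltL] : exists2 L, compact L /\ L `<=` setT & mu (setT `\` L) <= (e / 2)%:E.
  by apply: inner_regular_open_lt => //; exact: openT.
have mV : measurable (V : set (borel T)) by exact: open_borel.
have mL : measurable (L : set (borel T)) by exact: compact_borel.
exists (L `&` ~` V).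
  split; first by apply: compact_closedI => //; exact: open_closedC.
  by move=> x [_ nVx]; apply: contrapT => nAx; exact/nVx/AV.
apply: (@le_trans _ _ (mu ((V `\` ~` A) `|` (setT `\` L)))).
  apply: le_measure; rewrite ?inE.
  - by apply: measurableD => //; apply: measurableI => //; exact: measurableC.
  - by apply: measurableU; apply: measurableD => //; exact: measurableC.
  move=> x [Ax nK]; case: (pselect (L x)) => Lx; last by right.
  by left; split => //; apply: contrapT => nV; exact: nK.
apply: (@le_trans _ _ ((e / 2)%:E + (e / 2)%:E)); last first.
  by rewrite -EFinD -splitr.
apply: (le_trans (measureU2 _ _ _)).
- by apply: measurableD => //; exact: measurableC.
- exact: measurableD.
- exact: leeD.
Qed.

End inner_regularity.

(** Tube argument: lower semicontinuity gives a product neighbourhood of each [(x, y)], and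
    compactness of [K] makes its first factor uniform in [y]. *)
Lemma near_compact_section {R : realType} {X Y : ptopologicalType}
    (G : X * Y -> \bar R) (x : X) (K : set Y) (c : R) :
  lower_semicontinuous G -> compact K -> (forall y, K y -> c%:E < G (x, y)) ->
  \forall x' \near x, forall y, K y -> c%:E < G (x', y).
Proof.
move=> lG /compact_near_coveringP cK KG.
apply: (cK _ _ (fun x' y => c%:E < G (x', y))) => y Ky.
have [V [[A B] /= [nA nB] AB] VG] := lG _ _ (KG _ Ky).
by exists (B, A) => //= -[y' x'] [/= By' Ax']; apply/VG/(AB (x', y')).
Qed.

(** The factor [th < 1] turns [g <= G (x, _)] into a strict inequality, which survives on compact
    sets when [x] moves. Each value in [l] costs one compact approximation of its level set, with
    error [e]; [S] is the union of these compact sets. *)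
Lemma near_simple_section {R : realType} {X Y : ptopologicalType} (hY : hausdorff_space Y)
    (G : X * Y -> \bar R) (G_ge0 : forall z, 0 <= G z)
    (lG : lower_semicontinuous G) (nu : {measure set (borel Y) -> \bar R})
    (x : X) (th e : R) (g : {nnsfun borel Y >-> R}) (l : seq R) :
  radon nu -> nu setT < +oo -> (0 < th < 1)%R -> (0 < e)%R ->
  (forall y, (g y)%:E <= G (x, y)) ->
  exists S : set (borel Y), [/\ measurable S,
    nu ([set y | g y \in l] `\` S) <= (e *+ size l)%:E &
    \forall x' \near x, forall y, S y -> (th * g y)%:E <= G (x', y)].
Proof.
move=> rnu nufin /andP[th0 th1] e0 gG.
have mgl (s : seq R) : measurable [set y : borel Y | g y \in s].
  rewrite (_ : [set _ | _] = \bigcup_(r in [set` s]) (g @^-1` [set r])).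
    by apply: fin_bigcup_measurable.
  by apply/seteqP; split => y /= => [gy|[r /= rs ->]//]; exists (g y).
elim: l => [|r l [S [mS Sl Sx]]].
  exists set0; split => //.
    by rewrite (_ : _ `\` _ = set0) ?measure0// -subset0 => y [].
  by apply: nearW.
have mgr : measurable (g @^-1` [set r]) by [].
have [K [cK Kr] Ke] := inner_regular_borel_lt hY rnu nufin mgr e0.
have mK : measurable (K : set (borel Y)) by exact: compact_borel.
exists (S `|` K); split; first exact: measurableU.
  apply: (@le_trans _ _ (nu (([set y | g y \in l] `\` S) `|` (g @^-1` [set r] `\` K)))).
    apply: le_measure; rewrite ?inE.
    + by apply: measurableD => //; apply: measurableU.
    + by apply: measurableU; apply: measurableD.
    move=> y [/=]; rewrite inE => /orP[/eqP gyr|gyl] /not_orP[nSy nKy].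
      by right; split.
    by left; split.
  rewrite /= mulrSr EFinD; apply: (le_trans (measureU2 _ _ _)).
  + exact: measurableD.
  + exact: measurableD.
  + exact: leeD.
have Kx : \forall x' \near x, forall y, K y -> (th * r)%:E <= G (x', y).
  (* Shrinking a value [r <= 0] by [th] gives nothing strict, but then [G_ge0] suffices. *)
  have [r0|r0] := leP r 0%R.
    apply: nearW => x' y _; apply: le_trans (G_ge0 _).
    by rewrite lee_fin pmulr_rle0.
  have : forall y, K y -> (th * r)%:E < G (x, y).
    move=> y Ky; apply: lt_le_trans (gG y).
    by rewrite lte_fin (Kr _ Ky) gtr_pMl.
  by move=> /(near_compact_section lG cK); apply: filterS => x' + y Ky => /(_ _ Ky)/ltW.
near=> x' => y [Sy|Ky]; first by move: y Sy; near: x'.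
by rewrite (Kr _ Ky); move: y Ky; near: x'.
Unshelve. all: by end_near.
Qed.

(** The function [h] is a simple minorant of [G (x, _)], cut down to a large set [S] and scaled by
    [th < 1]; both losses fit in the gap between [t] and the integral of the minorant. *)
Lemma potential_gt_near {R : realType} {X Y : ptopologicalType}
    (hY : hausdorff_space Y)
    (G : X * Y -> \bar R) (G_ge0 : forall z, 0 <= G z)
    (lG : lower_semicontinuous G) (nu : {measure set (borel Y) -> \bar R})
    (x : X) (t : R) :
  radon nu -> nu setT < +oo -> (0 <= t)%R -> t%:E < potential G nu x ->
  exists h : borel Y -> \bar R, [/\ measurable_fun setT h,
    forall y, 0 <= h y, t%:E < \int[nu]_y h y &
    \forall x' \near x, forall y, h y <= G (x', y)].
Proof.
move=> rnu nufin t0; rewrite /potential ge0_integralTE//.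
case/ereal_sup_gt => _ [g gG <-]; rewrite -integralT_nnsfun => ltg.
have [B B0 gB] : exists2 B : R, (0 < B)%R & forall y, (g y <= B)%R.
  have [M [_ gM]] := simple_bounded g.
  (* Boundedness of [g] is only granted for bounds strictly above [M]; adding 1 provides this and
     positivity. *)
  exists (Num.max M 0 + 1)%R; first by rewrite ltr_pwDr// le_max lexx orbT.
  move=> y; apply: le_trans (ler_norm _) _; apply: gM => //.
  by rewrite ltr_pwDr// le_max lexx.
have Ifin : \int[nu]_y (g y)%:E \is a fin_num.
  rewrite ge0_fin_numE; last by apply: integral_ge0 => y _; rewrite lee_fin.
  apply: (@le_lt_trans _ _ (\int[nu]_y (cst B%:E) y)).
    apply: ge0_le_integral => //.
    - by move=> y _; rewrite lee_fin.
    - exact/measurable_EFinP.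
    - by move=> y _ /=; rewrite lee_fin.
  by rewrite integral_cst// lte_mul_pinfty// lee_fin ltW.
move: ltg; set J := \int[nu]_y _ in Ifin *; rewrite -(fineK Ifin) lte_fin.
set I := fine J => ltI; have I0 : (0 < I)%R by apply: le_lt_trans ltI.
(* With this [th] and the [e] below, [th * (I - B * e) = (I + t) ^+ 2 / (4 * I)], which exceeds [t]
   by [(I - t) ^+ 2 / (4 * I)]. *)
pose th := ((t + I) / (I + I))%R.
have th01 : (0 < th < 1)%R.
  apply/andP; split; first by apply: divr_gt0; [exact: ltr_wpDl|exact: addr_gt0].
  by rewrite ltr_pdivrMr ?addr_gt0// mul1r ltrD2r.
pose e := ((I - t) / (B + B))%R.
have e0 : (0 < e)%R by rewrite divr_gt0 ?subr_gt0// addr_gt0.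
(* [l] lists the whole range of [g], so its level sets fill [Y]. The tolerance is shared among the
   values; the successor in the divisor keeps it positive. *)
pose l := finmap.enum_fset (fset_set (range g)).
have e'0 : (0 < e / (size l).+1%:R)%R by rewrite divr_gt0.
have [S [mS Sl Sx]] := near_simple_section hY G_ge0 lG l rnu nufin th01 e'0 gG.
have lT : [set y | g y \in l] = setT.
  by apply/seteqP; split => // y _ /=; rewrite in_fset_set ?inE//; exists y.
have Se : nu (~` S) <= e%:E.
  rewrite lT setTD in Sl; apply: le_trans Sl _.
  by rewrite lee_fin -[leLHS]mulr_natr -mulrA ler_piMr ?ltW// mulrC ltr_pdivrMr// mul1r ltr_nat.
have mCS : measurable (~` S) by exact: measurableC.
have mg : measurable_fun setT (EFin \o g) by exact/measurable_EFinP.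
exists (fun y => th%:E * ((EFin \o g) \_ S) y); split.
- apply: measurable_funeM; apply/(measurable_restrictT _ _).1 => //.
  exact: measurable_funS mg.
- move=> y; rewrite /patch; case: ifPn => _; last by rewrite mule0.
  by rewrite mule_ge0// lee_fin// ltW//; case/andP: th01.
- case/andP: th01 => th0 _; rewrite ge0_integralZl_EFin//; last 3 first.
  + by move=> y _; rewrite /patch; case: ifPn => // _; rewrite lee_fin.
  + by apply/(measurable_restrictT _ _).1 => //; exact: measurable_funS mg.
  + exact: ltW.
  rewrite -integral_mkcond.
  have intC : \int[nu]_(y in ~` S) (g y)%:E <= (B * e)%:E.
    apply: (@le_trans _ _ (\int[nu]_(y in ~` S) (cst B%:E) y)).
      apply: ge0_le_integral => //.
      - by move=> y _; rewrite lee_fin.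
      - exact: measurable_funS mg.
      - by move=> y _ /=; rewrite lee_fin.
    by rewrite integral_cst//= EFinM lee_wpmul2l// lee_fin ltW.
  have JE : J = \int[nu]_(y in S) (g y)%:E + \int[nu]_(y in ~` S) (g y)%:E.
    rewrite -ge0_integral_setU// ?setUv//.
    - by move=> y _; rewrite lee_fin.
    - by rewrite disj_set2E setICr.
  have : (I - B * e)%:E <= \int[nu]_(y in S) (g y)%:E.
    rewrite EFinB leeBlDr// /I fineK// JE; exact: leeD.
  rewrite -(@lee_pmul2l _ th%:E)// ?lte_fin//; move=> Ile; apply: lt_le_trans Ile.
  rewrite -EFinM lte_fin; clearbody I.
  have BN0 : B != 0%R by rewrite gt_eqF.
  have IN0 : I != 0%R by rewrite gt_eqF.
  have -> : (I - B * e = (I + t) / 2)%R by rewrite /e; field; rewrite -mulr2n mulrn_eq0.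
  have -> : (th * ((I + t) / 2) = (I + t) ^+ 2 / (I * 4))%R by rewrite /th; field; rewrite IN0 -mulr2n mulrn_eq0.
  rewrite ltr_pdivlMr ?mulr_gt0//.
  have -> : ((I + t) ^+ 2 = t * (I * 4) + (I - t) ^+ 2)%R by ring.
  by rewrite ltrDl exprn_gt0// subr_gt0.
- move: Sx; apply: filterS => x' Sx y; rewrite /patch.
  case: ifPn => [|_]; last by rewrite mule0.
  by rewrite inE => /Sx; rewrite EFinM.
Qed.

(** * From capacity to weak type *)

Lemma ge0_integral_setID d (T : measurableType d) (R : realType)
    (mu : {measure set T -> \bar R}) (f : T -> \bar R) (A B : set T) :
  measurable_fun setT f -> (forall x, 0 <= f x) -> measurable A ->
  measurable B ->
  \int[mu]_(x in A) f x =
    \int[mu]_(x in A `&` B) f x + \int[mu]_(x in A `\` B) f x.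
Proof.
move=> mf f0 mA mB; rewrite -[in LHS](setUIDK A B) ge0_integral_setU//.
- exact: measurableI.
- exact: measurableD.
- exact: measurable_funTS.
- by rewrite disj_set2E; apply/eqP; rewrite -subset0 => x [[_ Bx] []].
Qed.

Lemma measure_cst_le_integral d (T : measurableType d) (R : realType)
    (mu : {measure set T -> \bar R}) (f : T -> \bar R) (A : set T) (c : \bar R) :
  measurable A -> measurable_fun setT f -> 0 <= c ->
  (forall x, A x -> c <= f x) -> mu A * c <= \int[mu]_(x in A) f x.
Proof.
move=> mA mf c0 cf; rewrite muleC -integral_cst//.
by apply: ge0_le_integral => //; exact: measurable_funTS.
Qed.

Lemma lsc_sectionl {R : realType} {X Y : ptopologicalType} (G : X * Y -> \bar R)
  (y : Y) : lower_semicontinuous G -> lower_semicontinuous (fun x => G (x, y)).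
Proof.
move=> lG x a /lG[V [[A B] /= [nA nB] AB] VG]; exists A => // x' Ax'.
by apply/VG/AB; split => //; exact: nbhs_singleton.
Qed.

Lemma lsc_sectionr {R : realType} {X Y : ptopologicalType} (G : X * Y -> \bar R)
  (x : X) : lower_semicontinuous G -> lower_semicontinuous (fun y => G (x, y)).
Proof.
move=> lG y a /lG[V [[A B] /= [nA nB] AB] VG]; exists B => // y' By'.
by apply/VG/AB; split => //; exact: nbhs_singleton.
Qed.

(** The minorant [h] found at [x] still lies below [G (x', _)] for [x'] near [x], and its integral
    already exceeds [t]. *)
Lemma open_potential_gt {R : realType} {X Y : ptopologicalType}
    (hY : hausdorff_space Y)
    (G : X * Y -> \bar R) (G_ge0 : forall z, 0 <= G z)
    (lG : lower_semicontinuous G) (nu : {measure set (borel Y) -> \bar R})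
    (t : R) : radon nu -> nu setT < +oo -> (0 <= t)%R ->
  open [set x | t%:E < potential G nu x].
Proof.
move=> rnu nufin t0; rewrite openE => x /= tx.
have [h [mh h0 th hG]] := potential_gt_near hY G_ge0 lG rnu nufin t0 tx.
apply: filterS hG => x' hG; apply: (lt_le_trans th).
apply: ge0_le_integral => //.
exact: (@lsc_borel R Y (fun y => G (x', y)) (lsc_sectionr lG)).
Qed.

(** * Duality between the potential and the adjoint potential on compact sets *)

Section dual_bound.
Context {R : realType} {X Y : ptopologicalType}.
Variable G : X * Y -> \bar R.
Variables (mu : {measure set (borel X) -> \bar R}).
Variables (nu : {measure set (borel Y) -> \bar R}).
Hypothesis G_ge0 : forall z, 0 <= G z.
Hypothesis lG : lower_semicontinuous G.

(** Replaces Fubini. Cut [A] into disjoint pieces, each inside one [U i], and let [w] be the sum of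
    the [h i] weighted by the [mu]-masses of the pieces. On each piece [h i] is a lower bound for
    [G] that does not depend on [x]. *)
Lemma adjoint_minorant (t : R) (U : X -> set X) (h : X -> borel Y -> \bar R)
    (s : seq X) : (0 <= t)%R ->
  (forall i, open (U i)) ->
  {in s, forall i, [/\ measurable_fun setT (h i),
    forall y, 0 <= h i y, t%:E <= \int[nu]_y h i y &
    forall x y, U i x -> h i y <= G (x, y)]} ->
  forall A : set (borel X), measurable A -> A `<=` \bigcup_(i in [set` s]) U i ->
  exists w : borel Y -> \bar R, [/\ measurable_fun setT w, forall y, 0 <= w y,
    forall y, w y <= \int[mu]_(x in A) G (x, y) &
    t%:E * mu A <= \int[nu]_y w y].
Proof.
move=> t0 oU; elim: s => [_ A mA|i s IHs Uh A mA AU].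
  rewrite set_nil bigcup_set0 subset0 => ->; exists (cst 0); split => //.
  - by move=> y; rewrite integral_set0.
  - by rewrite measure0 mule0 integral0.
have mU : measurable (U i : set (borel X)) by exact: open_borel.
have mG y : measurable_fun setT (fun x : borel X => G (x, y)).
  exact: (@lsc_borel R X (fun x => G (x, y)) (lsc_sectionl lG)).
have [mh h0 th hG] := Uh _ (mem_head i s).
have mAU : measurable (A `&` U i) by exact: measurableI.
have mADU : measurable (A `\` U i) by exact: measurableD.
have [| | w [mw w0 wG tw]] := IHs _ (A `\` U i) mADU.
- by move=> j js; apply: Uh; rewrite inE js orbT.
- move=> x [Ax nUx]; have [j /= + Ujx] := AU _ Ax.
  by rewrite inE => /orP[/eqP ji|js]; [rewrite -ji in nUx|exists j].
exists (fun y => mu (A `&` U i) * h i y + w y); split.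
- by apply: emeasurable_funD => //; exact: measurable_funeM.
- by move=> y; rewrite adde_ge0// mule_ge0.
- move=> y; rewrite (ge0_integral_setID mu (mG y) _ mA mU)//.
  apply: leeD => //; apply: (measure_cst_le_integral mu mAU (mG y)) => //.
  by move=> x [_ Ux]; exact: hG.
rewrite ge0_integralD//; last 2 first.
- by move=> y _; rewrite mule_ge0.
- exact: measurable_funeM.
rewrite ge0_integralZl// (measureDI _ mA mU) ge0_muleDr// addeC leeD//.
by rewrite muleC lee_wpmul2l.
Qed.

End dual_bound.

(** A finite subcover of [K] by the neighbourhoods of the local minorants yields [w] with [w <= 1],
    since [w] lies below the adjoint potential; integrating [w] against [nu] compares the two
    masses. *)
Lemma compact_potential_duality {R : realType} {X Y : ptopologicalType}
    (hX : hausdorff_space X) (hY : hausdorff_space Y)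
    (G : X * Y -> \bar R) (G_ge0 : forall z, 0 <= G z)
    (lG : lower_semicontinuous G)
    (mu : {measure set (borel X) -> \bar R})
    (nu : {measure set (borel Y) -> \bar R}) (t : R) (K : set X) :
  radon nu -> nu setT < +oo -> (0 <= t)%R -> compact K ->
  (forall x, K x -> t%:E < potential G nu x) ->
  (forall y, adjoint_potential G mu y <= 1) ->
  t%:E * mu K <= nu setT.
Proof.
move=> rnu nufin t0 cK Kt Gmu.
pose P x (U : set X) (h : borel Y -> \bar R) := [/\ open U /\ (K x -> U x),
  measurable_fun setT h, forall y, 0 <= h y,
  K x -> t%:E <= \int[nu]_y h y & forall x' y, U x' -> h y <= G (x', y)].
have ex x : exists Uh, P x Uh.1 Uh.2.
  have [Kx|nKx] := pselect (K x); last first.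
    (* A dummy pair off [K], so that the choice function is defined on all of [X]. *)
    exists (set0, cst 0); split => //=; split => //; exact: open0.
  have [h [mh h0 th]] := potential_gt_near hY G_ge0 lG rnu nufin t0 (Kt _ Kx).
  move=> hG; exists ([set x' | forall y, h y <= G (x', y)]^°, h); split => //=.
  - by split; [exact: open_interior|move=> _; exact: hG].
  - by move=> _; exact: ltW.
  - by move=> x' y /interior_subset.
have {ex} [Uh UhP] := choice ex.
have mK : measurable (K : set (borel X)) by exact: compact_borel.
move: (cK); rewrite compact_cover => /(_ X K (fun x => (Uh x).1)).
case; [by move=> x _; have [[]] := UhP x|by move=> x Kx; exists x => //; have [[_ /(_ Kx)]] := UhP x|].
move=> D DK KD.
have [||w [mw w0 wG tw]] := @adjoint_minorant R X Y G mu nu G_ge0 lG t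
    (fun x => (Uh x).1) (fun x => (Uh x).2) (finmap.enum_fset D) t0 _ _ K mK KD.
- by move=> x; have [[]] := UhP x.
- by move=> x /DK; rewrite inE => Kx; have [_ ? ? /(_ Kx)] := UhP x.
apply: (le_trans tw); rewrite -[leRHS]mul1e -integral_cst//.
apply: ge0_le_integral => // y _ /=.
apply: (le_trans (wG y)); apply: le_trans (Gmu y).
have mG : measurable_fun setT (fun x : borel X => G (x, y)).
  exact: (@lsc_borel R X (fun x => G (x, y)) (lsc_sectionl lG)).
exact: (@ge0_subset_integral _ _ _ _ _ _ _ _ _ mG).
Qed.

Lemma le_poweR {R : realType} (r : R) (x y : \bar R) :
  (0 <= r)%R -> 0 <= x -> x <= y -> x `^ r <= y `^ r.
Proof.
move=> r0 x0 xy; apply: gt0_ler_poweR => //; rewrite in_itv/= leey andbT//.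
exact: le_trans xy.
Qed.

Lemma cap0_ge0 {R : realType} {X Y : ptopologicalType} (G : X * Y -> \bar R)
  (K : set X) : 0 <= cap0 G K.
Proof.
apply: ereal_sup_ubound; exists (mzero : {measure set (borel X) -> \bar R}) => //.
split => //.
- split.
  + by move=> x; exists setT; split; [exact: openT| |rewrite /= /mzero ltry].
  + move=> A mA; apply/eqP; rewrite eq_le; apply/andP; split.
      by apply: le_ereal_inf_tmp => _ [U _ <-].
    by apply: ereal_inf_lbound; exists setT => //; split => //; exact: openT.
  + move=> U oU; apply/eqP; rewrite eq_le; apply/andP; split.
      by apply: ereal_sup_ubound; exists set0 => //; split => //; exact: compact0.
    by apply: ge_ereal_sup => _ [K' _ <-].
- by move=> y; rewrite /adjoint_potential integral_measure_zero.
Qed.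

Lemma weak_type_of_capacity {R : realType} {X Y : ptopologicalType}
    (hX : hausdorff_space X) (hY : hausdorff_space Y)
    (G : X * Y -> \bar R) (G_ge0 : forall z, 0 <= G z)
    (lG : lower_semicontinuous G) (q : R) (q_gt0 : (0 < q)%R)
    (sigma : {measure set (borel X) -> \bar R}) (sigma_radon : radon sigma)
    (C : R) (C_gt0 : (0 < C)%R) :
  (forall K : set X, compact K ->
     sigma K <= (C `^ q)%:E * (cap0 G K) `^ q) ->
  forall nu : {measure set (borel Y) -> \bar R}, radon nu ->
     weak_Lnorm sigma q (potential G nu) <= C%:E * nu [set: Y].
Proof.
move=> cap nu rnu.
have [nuoo|nufin] := eqVneq (nu setT) +oo.
  by rewrite [nu _]nuoo gt0_muley ?lte_fin// leey.
have {}nufin : nu setT < +oo by rewrite ltey.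
have nufn : nu setT \is a fin_num by rewrite ge0_fin_numE.
apply: ge_ereal_sup => _ [t /= t0 <-].
have p0 x : 0 <= potential G nu x by exact: integral_ge0.
rewrite (_ : [set x | _] = [set x | t%:E < potential G nu x]); last first.
  by apply/seteqP; split => x /=; rewrite gee0_abs.
have oA := open_potential_gt hY G_ge0 lG rnu nufin (ltW t0).
set A := [set x | _] in oA *.
set n := fine (nu setT); have nE : nu setT = n%:E by rewrite fineK.
have n0 : (0 <= n)%R by rewrite fine_ge0.
suff : sigma A <= ((C * n / t) `^ q)%:E.
  move=> As; rewrite [nu _]nE -EFinM -lee_pdivlMl//.
  apply: (@le_trans _ _ (((C * n / t) `^ q)%:E `^ q^-1)).
    by apply: le_poweR => //; rewrite invr_ge0 ltW.
  rewrite poweR_EFin -powRrM divff ?gt_eqF// powRr1; last first.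
    by rewrite divr_ge0 ?mulr_ge0// ltW.
  by rewrite muleC -EFinM.
(* [A] is open, so only compact [K] inside [A] matter; for these, duality bounds [cap0 G K] by
   [n / t]. *)
case: sigma_radon => _ _ ->//.
apply: ge_ereal_sup => _ [K [cK KA] <-].
apply: (le_trans (cap _ cK)).
have cap_le : cap0 G K <= (n / t)%:E.
  apply: ge_ereal_sup => _ [mu [rmu _ Gmu] <-].
  have := compact_potential_duality hX hY G_ge0 lG rnu nufin (ltW t0) cK KA Gmu.
  by rewrite nE EFinM muleC lee_pdivlMr// muleC.
have cap_ge0 := cap0_ge0 G K.
rewrite -mulrA powRM; [|exact: ltW|by apply: divr_ge0 => //; exact: ltW].
rewrite EFinM lee_pmul2l// ?lte_fin ?powR_gt0// -poweR_EFin.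
by apply: le_poweR => //; exact: ltW.
Qed.

(** * Minimax for dominated measures *)

(* Blackwell's argument: playing against the weights [w j = max 0 (S j)], [S]
   being the accumulated excess over [t0], makes the squared distance of [S] to
   the negative orthant grow at most linearly in the number of rounds. *)
Lemma convex_approachability {R : realType} (I : finType) (L : set (I -> R))
    (B t0 T : R) :
  (forall u v a, L u -> L v -> (0 <= a <= 1)%R ->
    L (fun j => (1 - a) * u j + a * v j)%R) ->
  (forall u j, L u -> (`|u j| <= B)%R) ->
  (forall w : I -> R, (forall j, 0 <= w j)%R ->
    exists2 u, L u & (\sum_j w j * u j <= t0 * \sum_j w j)%R) ->
  (t0 < T)%R ->
  exists2 u, L u & forall j, (u j <= T)%R.
Proof.
move=> Lconv LB Lw t0T.
pose b := ((B + `|t0|) ^+ 2)%R.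
have Lb u j : L u -> ((u j - t0) ^+ 2 <= b)%R.
  move=> Lu; rewrite -real_normK ?num_real// lerXn2r ?nnegrE ?normr_ge0//.
    by rewrite addr_ge0// (le_trans _ (LB _ j Lu)).
  by apply: le_trans (ler_normB _ _) _; rewrite lerD2r LB.
(* Here [u] is the average of the first [k.+1] points played, so [k.+1%:R * (u j - t0)] is the
   accumulated excess in coordinate [j]. *)
have step k : exists2 u, L u &
    (\sum_j Num.max 0 (k.+1%:R * (u j - t0)) ^+ 2 <= k.+1%:R * \sum_(j : I) b)%R.
  elim: k => [|k [u Lu uk]].
    have [//|u Lu _] := Lw (fun=> 0%R); exists u => //.
    rewrite mul1r; apply: ler_sum => j _; apply: le_trans (Lb _ j Lu).
    rewrite mul1r; case: (leP 0%R (u j - t0)%R) => // _.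
    by rewrite expr0n/= sqr_ge0.
  pose w j := Num.max 0%R (k.+1%:R * (u j - t0))%R.
  have w0 j : (0 <= w j)%R by rewrite le_max lexx.
  have [v Lv vw] := Lw _ w0.
  (* The weight of the new point [v] in the running average. *)
  pose a : R := (k.+2%:R^-1)%R.
  have aE : (k.+2%:R * a = 1)%R by rewrite divff.
  exists (fun j => (1 - a) * u j + a * v j)%R.
    apply: Lconv => //; rewrite invr_ge0 ler0n/=.
    by rewrite invf_le1// ler1n.
  have E j : (k.+2%:R * ((1 - a) * u j + a * v j - t0) =
      k.+1%:R * (u j - t0) + (v j - t0))%R.
    transitivity ((k.+2%:R - k.+2%:R * a) * u j + (k.+2%:R * a) * v j - k.+2%:R * t0)%R.
      by ring.
    by rewrite aE -natr1; ring.
  (* The positive part of [S + z] is at most the absolute value of [w j + z]. Expanding the square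
     leaves a cross term whose sum over [j] is nonpositive by the choice of [v]. *)
  have le1 j : (Num.max 0 (k.+2%:R * ((1 - a) * u j + a * v j - t0)) ^+ 2 <=
      w j ^+ 2 + 2 * (w j * v j - t0 * w j) + b)%R.
    apply: (@le_trans _ _ ((w j + (v j - t0)) ^+ 2)%R).
      rewrite E; case: (leP 0%R (k.+1%:R * (u j - t0) + (v j - t0))%R) => [S0|_].
        have le : (k.+1%:R * (u j - t0) + (v j - t0) <= w j + (v j - t0))%R.
          by rewrite lerD2r le_max lexx orbT.
        by rewrite lerXn2r// nnegrE// (le_trans S0).
      by rewrite expr0n/= sqr_ge0.
    have := Lb _ j Lv; set z := (v j - t0)%R => zb.
    have -> : ((w j + z) ^+ 2 = w j ^+ 2 + 2 * (w j * v j - t0 * w j) + z ^+ 2)%R.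
      by rewrite /z; ring.
    by rewrite lerD2l.
  apply: (le_trans (ler_sum _ (fun j _ => le1 j))).
  rewrite !big_split/= -mulr_sumr sumrB -[X in (_ - X)%R]mulr_sumr.
  have -> : (k.+2%:R * \sum_(j : I) b = k.+1%:R * (\sum_(j : I) b) + \sum_(j : I) b)%R.
    by rewrite -natr1 mulrDl mul1r.
  rewrite lerD2r -[leRHS]addr0 lerD//.
  by rewrite pmulr_rle0// subr_le0.
(* A coordinate with [u j > T] would force [k.+1%:R <= c] by the invariant, so any larger [k]
   works. *)
pose c := (\sum_(j : I) b / (T - t0) ^+ 2)%R.
have [k ck] : exists k : nat, (c < k.+1%:R)%R.
  have c0 : (0 <= c)%R.
    by apply: sumr_ge0 => j _; rewrite divr_ge0// sqr_ge0.
  by exists (Num.bound c); apply: lt_trans (archi_boundP c0) _; rewrite ltr_nat.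
have [u Lu uk] := step k; exists u => // j; rewrite leNgt; apply/negP => Tu.
have Tt0 : (0 < T - t0)%R by rewrite subr_gt0.
have : (k.+1%:R ^+ 2 * (T - t0) ^+ 2 <= k.+1%:R * \sum_(j : I) b)%R.
  apply: le_trans uk; rewrite (bigD1 j)//= -[leLHS]addr0 lerD//; last first.
    by apply: sumr_ge0 => i _; exact: sqr_ge0.
  have S0 : (0 <= k.+1%:R * (T - t0))%R by rewrite mulr_ge0// ltW.
  have S1 : (k.+1%:R * (T - t0) <= Num.max 0 (k.+1%:R * (u j - t0)))%R.
    by rewrite le_max ler_pM2l// lerD2r (ltW Tu) orbT.
  by rewrite -exprMn lerXn2r// nnegrE// (le_trans S0).
rewrite expr2 -mulrA ler_pM2l// -ler_pdivlMr ?exprn_gt0// mulr_suml.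
by rewrite leNgt ck.
Qed.

(** * Finitely additive contents dominated by a finite measure, and their ultrafilter limits *)

Section dominated_contents.
Context {d : measure_display} {T : measurableType d} {R : realType}.
Variable m : {measure set T -> \bar R}.
Hypothesis m_fin : m setT < +oo.

Let m_fin_num A : measurable A -> m A \is a fin_num.
Proof.
move=> mA; rewrite ge0_fin_numE//; apply: le_lt_trans m_fin.
by apply: le_measure; rewrite ?inE.
Qed.

(** Positivity is asked of every set, measurable or not, because a measure is a total function that
    is nonnegative everywhere. Real values allow limits to be taken in compact segments. *)
Definition dominated_content (phi : set T -> R) :=
  [/\ forall A, (0 <= phi A)%R,
    forall A, measurable A -> (phi A)%:E <= m A &
    forall A B, measurable A -> measurable B -> A `&` B = set0 ->
      phi (A `|` B) = (phi A + phi B)%R].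

Lemma dominated_content_bigU (phi : set T -> R) (F : nat -> set T) (n : nat) :
  dominated_content phi -> (forall i, measurable (F i)) ->
  trivIset setT F ->
  (\sum_(0 <= i < n) phi (F i))%R = phi (\big[setU/set0]_(i < n) F i).
Proof.
move=> [phi0 phim phiD] mF tF; elim: n => [|n IHn].
  rewrite big_nil big_ord0; apply/eqP; rewrite eq_le phi0/= -lee_fin.
  by apply: le_trans (phim _ _) _ => //; rewrite measure0.
rewrite big_nat_recr//= IHn big_ord_recr/= phiD//.
  exact: bigsetU_measurable.
by rewrite -bigcup_mkord -subset0 => x [[i /= ilt Fix] Fnx];
  have ein := tF _ _ I I (ex_intro _ x (conj Fix Fnx)); rewrite ein ltnn in ilt.
Qed.

(* Domination makes countable additivity automatic. *)
Lemma measure_of_dominated_content (phi : set T -> R) : dominated_content phi ->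
  exists mu : {measure set T -> \bar R}, forall A, mu A = (phi A)%:E.
Proof.
move=> dphi; have [phi0 phim phiD] := dphi.
pose p A := (phi A)%:E.
have p0 : p set0 = 0.
  apply/eqP; rewrite eq_le !lee_fin phi0 andbT -lee_fin.
  by apply: le_trans (phim _ _) _ => //; rewrite measure0.
have pge0 A : 0 <= p A by rewrite lee_fin.
have psigma : semi_sigma_additive p.
  move=> F mF tF mUF.
  (* These remainders decrease to the empty set, so their [m]-measure, which bounds the missing part
     of the series, tends to 0. *)
  pose Rst n := \bigcup_n F n `\` \big[setU/set0]_(i < n) F i.
  have mb n : measurable (\big[setU/set0]_(i < n) F i).
    exact: bigsetU_measurable.
  have mRst n : measurable (Rst n) by exact: measurableD.
  have sumE n : \sum_(0 <= i < n) p (F i) = p (\big[setU/set0]_(i < n) F i).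
    by rewrite sumEFin dominated_content_bigU.
  have pE n : p (\bigcup_n F n) = p (\big[setU/set0]_(i < n) F i) + p (Rst n).
    rewrite -EFinD -phiD//; last first.
      by rewrite -subset0 => x [Ux []].
    rewrite /p /Rst setDUK//.
    by rewrite -bigcup_mkord; apply: bigcup_sub => i _; exact: bigcup_sup.
  have mcvg : m (Rst n) @[n --> \oo] --> 0.
    rewrite -[X in _ --> X](measure0 m).
    have <- : \bigcap_n Rst n = set0.
      rewrite -subset0 => x Rx; have [[i _ Fix] _] := Rx 0%N I.
      have [_] := Rx i.+1 I; apply; rewrite -bigcup_mkord.
      by exists i => /=.
    apply: nonincreasing_cvg_mu => //.
    - by apply: le_lt_trans m_fin; apply: le_measure; rewrite ?inE.
    - exact: bigcapT_measurable.
    - move=> i j ij; apply/subsetPset => x [Ux nx]; split => // xi.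
      apply: nx; move: xi; rewrite -!bigcup_mkord => -[k /= ki Fkx].
      by exists k => //=; exact: leq_trans ij.
  under eq_fun do rewrite sumE.
  apply: (@squeeze_cvge _ _ _ _ (fun n => p (\bigcup_n F n) - m (Rst n)) _
    (fun=> p (\bigcup_n F n))).
  - apply: nearW => n.
    have le1 : p (\bigcup_n F n) <= p (\big[setU/set0]_(i < n) F i) + m (Rst n).
      by rewrite (pE n) leeD2l//; exact: phim.
    have le2 : p (\big[setU/set0]_(i < n) F i) <= p (\bigcup_n F n).
      by rewrite (pE n) leeDl.
    by apply/andP; split => //; rewrite leeBlDr// m_fin_num.
  - rewrite -[X in _ --> X]sube0; apply: cvgeB => //; exact: cvg_cst.
  - exact: cvg_cst.
pose mix := isMeasure.Build _ _ _ p p0 pge0 psigma.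
pose mu : {measure set T -> \bar R} := HB.pack p mix.
by exists mu.
Qed.

(* Meant for [f] with finite range; otherwise [fset_set] is empty and this is 0. *)
Definition content_sint (f : T -> R) (phi : set T -> R) : R :=
  (\sum_(r <- finmap.enum_fset (fset_set (range f))) r * phi (f @^-1` [set r]))%R.

Lemma sintegral_content (mu : {measure set T -> \bar R}) (phi : set T -> R)
    (f : {nnsfun T >-> R}) :
  (forall A, measurable A -> mu A = (phi A)%:E) ->
  \int[mu]_x (f x)%:E = (content_sint f phi)%:E.
Proof.
move=> muE; rewrite integralT_nnsfun sintegralE fsbig_finite//= -sumEFin.
by apply: eq_bigr => r _; rewrite muE// EFinM.
Qed.

(** Compactness of the segment gives a cluster point, and a cluster point of an ultrafilter is a
    limit. *)
Lemma ultra_bounded_cvg {I : Type} (U : set_system I) (f : I -> R) (a b : R) :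
  UltraFilter U -> U [set i | (a <= f i <= b)%R] -> cvg (f i @[i --> U]).
Proof.
move=> uU Uab; have pU : ProperFilter U by exact: ultra_proper.
have [] := @segment_compact R a b (f @ U) _ _.
  by apply: (@filterS _ U) Uab => i /=; rewrite in_itv.
move=> p [_ clp]; apply/cvg_ex; exists p => N nN.
have [//|UnN] := in_ultra_setVsetC (f @^-1` N) uU.
by have [x []] := clp (~` N) N UnN nN.
Qed.

(** Each defining condition involves finitely many sets and is closed, so it passes to setwise
    limits; these exist because [phi A] stays between 0 and [m A]. *)
Lemma ultra_dominated_content (U : set_system (set T -> R)) :
  UltraFilter U -> U dominated_content ->
  exists2 psi, dominated_content psi &
    forall A, measurable A -> phi A @[phi --> U] --> psi A.
Proof.
move=> uU Ud; have pU : ProperFilter U by exact: ultra_proper.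
have cvA A : measurable A -> cvg (phi A @[phi --> U]).
  move=> mA; apply: (@ultra_bounded_cvg _ U _ 0 (fine (m A))) => //.
  move: Ud; apply: filterS => phi [phi0 phim _] /=.
  by rewrite phi0/= -lee_fin fineK ?phim// m_fin_num.
(* The absolute value enforces positivity on nonmeasurable sets, where convergence is not known; on
   measurable sets it changes nothing. *)
pose psi A : R := (`|lim (phi A @[phi --> U])|)%R.
have cvpsi A : measurable A -> phi A @[phi --> U] --> psi A.
  move=> mA; rewrite /psi ger0_norm; first exact: cvA.
  apply: limr_ge; first exact: cvA.
  by move: Ud; apply: filterS => phi [].
exists psi => //; split.
- by move=> A; rewrite normr_ge0.
- move=> A mA; rewrite -[m A]fineK ?m_fin_num// lee_fin.
  rewrite -(cvg_lim (@Rhausdorff R) (cvpsi _ mA)); apply: limr_le; first exact: cvA.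
  move: Ud; apply: filterS => phi [phi0 phim _] /=.
  by rewrite -lee_fin fineK ?phim// m_fin_num.
- move=> A B mA mB AB.
  have cvAB : phi (A `|` B) @[phi --> U] --> (psi A + psi B)%R.
    have cvD : (phi A + phi B)%R @[phi --> U] --> (psi A + psi B)%R.
      by apply: cvgD; exact: cvpsi.
    move: cvD; apply: cvg_trans; apply: near_eq_cvg.
    by move: Ud; apply: filterS => phi [_ _ ->].
  have mAB : measurable (A `|` B) by exact: measurableU.
  by rewrite -(cvg_lim (@Rhausdorff R) (cvpsi _ mAB)) (cvg_lim (@Rhausdorff R) cvAB).
Qed.

Lemma cvg_content_sint (U : set_system (set T -> R)) (psi : set T -> R)
    (f : {nnsfun T >-> R}) : Filter U ->
  (forall A, measurable A -> phi A @[phi --> U] --> psi A) ->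
  content_sint f phi @[phi --> U] --> content_sint f psi.
Proof.
move=> fU cv; rewrite /content_sint; elim: (finmap.enum_fset _) => [|r s IHs].
  by under eq_fun do rewrite big_nil; rewrite big_nil; exact: cvg_cst.
under eq_fun do rewrite big_cons; rewrite big_cons.
by apply: cvgD => //; apply: cvgM; [exact: cvg_cst|exact: cv].
Qed.

End dominated_contents.

(** * Minimax over probability measures dominated by [m] *)

Section dominated_minimax.
Context {d : measure_display} {T : measurableType d} {R : realType}.
Variable m : {measure set T -> \bar R}.
Hypothesis m_fin : m setT < +oo.

Let prob (phi : set T -> R) := dominated_content m phi /\ phi setT = 1%R.

Let prob_le1 phi A : prob phi -> measurable A -> (phi A <= 1)%R.
Proof.
move=> [[phi0 _ phiD] <-] mA; rewrite -(setUv A) phiD ?lerDl ?setICr//.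
exact: measurableC.
Qed.

Let prob_conv u v a : prob u -> prob v -> (0 <= a <= 1)%R ->
  prob (fun A => (1 - a) * u A + a * v A)%R.
Proof.
move=> [[u0 um uD] u1] [[v0 vm vD] v1] /andP[a0 a1].
have a10 : (0 <= 1 - a)%R by rewrite subr_ge0.
split; last by rewrite u1 v1; ring.
split.
- by move=> A; rewrite addr_ge0// mulr_ge0.
- move=> A mA; rewrite EFinD !EFinM.
  have -> : m A = (1 - a)%:E * m A + a%:E * m A.
    by rewrite -ge0_muleDl ?lee_fin// -EFinD subrK mul1e.
  by rewrite leeD// lee_wpmul2l ?lee_fin ?um ?vm.
- by move=> A B mA mB AB; rewrite uD// vD//; ring.
Qed.

Let content_sint_conv (f : T -> R) u v a :
  content_sint f (fun A => (1 - a) * u A + a * v A)%R =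
  ((1 - a) * content_sint f u + a * content_sint f v)%R.
Proof.
rewrite /content_sint !mulr_sumr -big_split/=; apply: eq_bigr => r _; ring.
Qed.

Let content_sint_bound (f : {nnsfun T >-> R}) u : prob u ->
  (`|content_sint f u| <=
    \sum_(r <- finmap.enum_fset (fset_set (range f))) `|r|)%R.
Proof.
move=> pu; rewrite /content_sint; apply: le_trans (ler_norm_sum _ _ _) _.
apply: ler_sum => r _; rewrite normrM ler_piMr// ger0_norm; first exact: prob_le1.
by case: pu => [[]].
Qed.

(** Approachability solves the problem for each finite subfamily of [S], at the price of the gap
    between [t0] and [t1]. The solution sets then generate a proper filter, and a limit along a
    finer ultrafilter satisfies all constraints at once. *)
Lemma dominated_minimax (S : set {nnsfun T >-> R}) (t0 t1 : R) : (t0 < t1)%R ->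
  (forall (I : finType) (s : I -> {nnsfun T >-> R}) (w : I -> R),
    (forall i, S (s i)) -> (forall i, 0 <= w i)%R ->
    exists mu : {measure set T -> \bar R},
      [/\ forall A, measurable A -> mu A <= m A, mu setT = 1 &
      \sum_i (w i)%:E * \int[mu]_x (s i x)%:E <= (t0 * \sum_i w i)%:E]) ->
  exists mu : {measure set T -> \bar R},
    [/\ forall A, measurable A -> mu A <= m A, mu setT = 1 &
    forall s, S s -> \int[mu]_x (s x)%:E <= t1%:E].
Proof.
move=> t01 H.
pose D := [set l : seq (T -> R) | forall f, f \in l ->
  exists2 s : {nnsfun T >-> R}, S s & (s : T -> R) = f].
pose B (l : seq (T -> R)) := [set phi | prob phi /\
  forall f, f \in l -> (content_sint f phi <= t1)%R].
have BF : Filter (filter_from D B).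
  apply: filter_from_filter; first by exists [::].
  move=> l k Dl Dk; exists (l ++ k).
    by move=> f; rewrite mem_cat => /orP[/Dl|/Dk].
  by move=> phi [pphi lphi]; split; split => // f fl; apply: lphi;
    rewrite mem_cat fl ?orbT.
have BP : ProperFilter (filter_from D B).
  apply: filter_from_proper => l Dl.
  have sP (i : 'I_(size l)) : exists s : {nnsfun T >-> R},
      S s /\ (s : T -> R) = nth (fun=> 0%R) l i.
    by have [|s Ss sE] := Dl (nth (fun=> 0%R) l i); [exact: mem_nth|exists s].
  have {sP} [s sP] := choice sP.
  (* Vectors of integrals of the listed functions; [L] is convex because [content_sint] is linear in
     [phi]. *)
  pose L := [set u : 'I_(size l) -> R | exists2 phi, prob phi &
    forall i, u i = content_sint (s i) phi].
  pose b := (\sum_i \sum_(r <- finmap.enum_fset (fset_set (range (s i)))) `|r|)%R.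
  have [|||u [phi pphi uE] ut] := @convex_approachability R _ L b t0 t1 _ _ _ t01.
  - move=> u v a [phi pphi uE] [psi ppsi vE] a01.
    exists (fun A => (1 - a) * phi A + a * psi A)%R; first exact: prob_conv.
    by move=> i; rewrite content_sint_conv uE vE.
  - move=> u i [phi pphi ->]; apply: le_trans (content_sint_bound _ pphi) _.
    rewrite /b (bigD1 i)//= lerDl; apply: sumr_ge0 => j _.
    by apply: sumr_ge0.
  - move=> w w0; have [|mu [mum mu1 muw]] := H _ s w _ w0.
      by move=> i; have [] := sP i.
    have muE A : measurable A -> mu A = (fine (mu A))%:E.
      move=> mA; rewrite fineK// ge0_fin_numE//.
      apply: le_lt_trans (mum _ mA) _; apply: le_lt_trans m_fin.
      by apply: le_measure; rewrite ?inE.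
    exists (fun i => content_sint (s i) (fun A => fine (mu A))).
      exists (fun A => fine (mu A)) => //; split; last by rewrite mu1.
      split.
      + by move=> A; rewrite fine_ge0.
      + by move=> A mA; rewrite -muE// mum.
      + move=> A C mA mC AC; apply/EFin_inj; rewrite EFinD -!muE//.
          exact: measureU.
        exact: measurableU.
    rewrite -lee_fin; apply: le_trans muw; rewrite -sumEFin.
    by apply: lee_sum => i _; rewrite EFinM (sintegral_content (s i) muE).
  exists phi; split => // f fl; have fi : (index f l < size l)%N by rewrite index_mem.
  have [_ sf] := sP (Ordinal fi); have := ut (Ordinal fi).
  by rewrite uE sf/= nth_index.
have [U [uU BU]] := ultraFilterLemma BP.
have pU : ProperFilter U by exact: ultra_proper.
have Uprob : U prob.
  by apply: BU; exists [::] => // phi [].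
have [|psi dpsi cvpsi] := ultra_dominated_content m_fin uU.
  by apply: filterS Uprob => phi [].
have [mu muE] := measure_of_dominated_content m_fin dpsi.
exists mu; split.
- by move=> A mA; rewrite muE; case: dpsi => _ /(_ _ mA).
- rewrite muE -(cvg_lim (@Rhausdorff R) (cvpsi _ measurableT)).
  congr EFin; apply: (cvg_lim (@Rhausdorff R)).
  apply: cvg_near_cst; apply: filterS Uprob => phi []//.
- move=> s Ss; rewrite (@sintegral_content _ _ _ mu psi)// lee_fin.
  have cvs : content_sint s phi @[phi --> U] --> content_sint s psi.
    exact: cvg_content_sint.
  rewrite -(cvg_lim (@Rhausdorff R) cvs); apply: limr_le.
    by apply/cvg_ex; exists (content_sint s psi).
  apply: BU; exists [:: (s : T -> R)].
    by move=> f; rewrite inE => /eqP ->; exists s.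
  by move=> phi [_]; apply; rewrite inE.
Qed.

End dominated_minimax.

(** * From weak type to capacity *)

Section radon_dominated.
Context {R : realType} {T : ptopologicalType}.
Hypothesis hT : hausdorff_space T.
Variable sigma : {measure set (borel T) -> \bar R}.
Hypothesis sigma_radon : radon sigma.

Lemma radon_compact_lty (K : set T) : compact K -> sigma K < +oo.
Proof.
case: sigma_radon => lf _ _ cK.
have [U UP] := choice lf.
have oU x : open (U x) by have [] := UP x.
have mU x : measurable (U x : set (borel T)) by exact: open_borel.
move: (cK); rewrite compact_cover => /(_ T K U); case=> // [x Kx|D _ KD].
  by exists x => //; have [] := UP x.
have Klt : forall s : seq T, sigma (\bigcup_(i in [set` s]) U i) < +oo.
  elim=> [|x s IHs]; first by rewrite set_nil bigcup_set0 measure0.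
  have -> : [set` x :: s] = x |` [set` s].
    apply/seteqP; split => z /=; rewrite inE; first by case/orP => [/eqP|]; [left|right].
    by case=> [->|->]; rewrite ?eqxx ?orbT.
  rewrite bigcup_setU1; apply: le_lt_trans (measureU2 _ _ _) _ => //.
    by apply: fin_bigcup_measurable => //.
  by rewrite lte_add_pinfty//; have [] := UP x.
apply: le_lt_trans (Klt (finmap.enum_fset D)); apply: le_measure => //.
- by rewrite inE; exact: compact_borel.
- by rewrite inE; apply: fin_bigcup_measurable.
Qed.

(** A set whose trace on [K] has small [sigma]-measure has small [mu]-measure, so approximations for
    [sigma] near [K] serve for [mu]. Dividing by [M + 1] below avoids a case split at [M = 0]. *)
Lemma radon_dominated (mu : {measure set (borel T) -> \bar R}) (K : set T)
    (M : R) : compact K -> (0 <= M)%R ->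
  (forall A : set (borel T), measurable A -> mu A <= M%:E * sigma (A `&` K)) ->
  radon mu.
Proof.
move=> cK M0 muM; have Kfin := radon_compact_lty cK.
have mK : measurable (K : set (borel T)) by exact: compact_borel.
have M1 : (0 < M + 1)%R by rewrite ltr_pwDr.
have small (e : R) (A B : set (borel T)) : (0 < e)%R -> measurable A -> measurable B ->
    A `&` K `<=` B -> sigma B <= (e / (M + 1))%:E -> mu A <= e%:E.
  move=> e0 mA mB AB Be; apply: le_trans (muM _ mA) _.
  apply: (@le_trans _ _ (M%:E * (e / (M + 1))%:E)).
    apply: lee_wpmul2l; first by rewrite lee_fin.
    by apply: le_trans Be; apply: le_measure; rewrite ?inE//; exact: measurableI.
  by rewrite -EFinM lee_fin mulrCA ler_piMr ?ltW// ltr_pdivrMr// mul1r ltrDl.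
split.
- move=> x; exists setT; split => //; first exact: openT.
  by apply: le_lt_trans (muM _ _) _ => //; rewrite setTI lte_mul_pinfty.
- move=> A mA; apply/eqP; rewrite eq_le; apply/andP; split.
    apply: le_ereal_inf_tmp => _ [U [oU AU] <-]; apply: le_measure; rewrite ?inE//.
    exact: open_borel.
  apply/lee_addgt0Pr => e e0.
  have mAK : measurable (A `&` K) by exact: measurableI.
  have [||V [oV AV] Ve] := outer_regular_lt sigma_radon (e := (e / (M + 1))%R) mAK.
  + by apply: le_lt_trans Kfin; apply: le_measure; rewrite ?inE.
  + exact: divr_gt0.
  (* Adding [~] K[makes the open set contain all of]A[at no cost, as]mu[does not charge]~[K]. *)
  have oU : open (V `|` ~` K).
    by apply: openU => //; apply: closed_openC; exact: compact_closed.
  have mV := open_borel oV; have mU := open_borel oU.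
  apply: (@le_trans _ _ (mu (V `|` ~` K))).
    apply: ereal_inf_lbound; exists (V `|` ~` K) => //; split => // x Ax.
    by have [Kx|] := pselect (K x); [left; apply: AV|right].
  have mUA : measurable ((V `|` ~` K) `\` A : set (borel T)) by exact: measurableD.
  apply: (@le_trans _ _ (mu (A `|` ((V `|` ~` K) `\` A)))).
    apply: le_measure; rewrite ?inE//; first exact: measurableU.
    by move=> x Ux; have [Ax|] := pselect (A x); [left|right].
  apply: le_trans (measureU2 _ _ _) _ => //; rewrite leeD2l//.
  apply: (small _ _ (V `\` (A `&` K))) => //; first exact: measurableD.
  by move=> x [[[Vx|//] nAx] Kx]; split => // -[].
- move=> U oU; apply/eqP; rewrite eq_le; apply/andP; split; last first.
    apply: ge_ereal_sup => _ [L [cL LU] <-]; apply: le_measure; rewrite ?inE//.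
      exact: compact_borel.
    exact: open_borel.
  apply/lee_addgt0Pr => e e0.
  (* [sigma U] may be infinite, so [U] is first cut down to an open neighbourhood [V] of [K] of
     finite measure; the tolerance 1 is arbitrary. *)
  have [|V [oV KV] Ve] := outer_regular_lt sigma_radon (e := 1%R) mK Kfin.
    by [].
  have mU := open_borel oU; have mV := open_borel oV.
  have oUV : open (U `&` V) by exact: openI.
  have UVfin : sigma (U `&` V) < +oo.
    apply: (@le_lt_trans _ _ (sigma (K `|` (V `\` K)))).
      apply: le_measure; rewrite ?inE; [exact: measurableI|..].
        by apply: measurableU => //; exact: measurableD.
      by move=> x [_ Vx]; have [Kx|] := pselect (K x); [left|right].
    apply: le_lt_trans (measureU2 _ _ _) _ => //; first exact: measurableD.
    by rewrite lte_add_pinfty// (le_lt_trans Ve)// ltry.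
  have [|L [cL LUV] Le] := inner_regular_open_lt hT sigma_radon (e := (e / (M + 1))%R) oUV UVfin.
    exact: divr_gt0.
  have mL : measurable (L : set (borel T)) by exact: compact_borel.
  apply: (@le_trans _ _ (mu (L `|` (U `\` L)))).
    apply: le_measure; rewrite ?inE//.
      by apply: measurableU => //; exact: measurableD.
    by move=> x Ux; have [Lx|] := pselect (L x); [left|right].
  apply: le_trans (measureU2 _ _ _) _ => //; first exact: measurableD.
  apply: leeD.
    by apply: ereal_sup_ubound; exists L => //; split => // x /LUV[].
  apply: (small _ _ ((U `&` V) `\` L)) => //; try exact: measurableD.
    by apply: measurableD => //; exact: measurableI.
  by move=> x [[Ux nLx] /KV].
Qed.

End radon_dominated.

(** * Finite combinations of Dirac masses *)

Section weighted_diracs.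
Context {R : realType} {T : ptopologicalType} {I : Type}.
Variables (w : I -> R) (y : I -> borel T).

Lemma weighted_diracs (r : seq I) : (forall i, 0 <= w i)%R ->
  exists nu : {measure set (borel T) -> \bar R},
    (forall A, nu A = \sum_(i <- r) (w i)%:E * \d_(y i) A) /\
    (forall f : borel T -> \bar R, measurable_fun setT f -> (forall x, 0 <= f x) ->
      \int[nu]_x f x = \sum_(i <- r) (w i)%:E * f (y i)).
Proof.
move=> w_ge0; elim: r => [|i r [nu [nuE nuI]]].
  exists mzero; split => [A|f mf f0]; rewrite big_nil//.
  exact: integral_measure_zero.
exists (measure_add (mscale (NngNum (w_ge0 i)) (dirac (y i))) nu); split.
  by move=> A; rewrite big_cons -nuE; exact: measure_addE.
move=> f mf f0; rewrite ge0_integral_measure_add// big_cons nuI//.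
by rewrite ge0_integral_mscale// integral_dirac// diracT mul1e.
Qed.

(** Only the finitely many atoms count, and finite sets are closed and compact: remove the atoms
    outside [A] for outer regularity, keep those inside [U] for inner regularity. [List.In] is used
    because [I] is a bare type. *)
Lemma radon_weighted_diracs (r : seq I) (nu : {measure set (borel T) -> \bar R}) :
  hausdorff_space T ->
  (forall A, nu A = \sum_(i <- r) (w i)%:E * \d_(y i) A) -> radon nu.
Proof.
move=> hT nuE.
have finY (P : set T) : finite_set (P `&` y @` [set i | List.In i r]).
  apply: finite_setIr; elim: r {nuE} => [|i r IHr].
    by rewrite (_ : _ @` _ = set0)// -subset0 => x [].
  apply: (@sub_finite_set _ _ ([set y i] `|` y @` [set i | List.In i r])).
    by move=> _ [j [<-|jr] <-]; [left|right; exists j].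
  by rewrite finite_setU.
have eqnu (A B : set (borel T)) :
    (forall i, List.In i r -> A (y i) <-> B (y i)) -> nu A = nu B.
  rewrite !nuE; elim: r {nuE finY} => [|i r IHr] AB; first by rewrite !big_nil.
  rewrite !big_cons IHr; last by move=> j jr; apply: AB; right.
  congr (_ * _ + _); rewrite !diracE; congr (_%:R%:E); congr nat_of_bool.
  by apply/idP/idP; rewrite !inE => ?; apply/(AB i) => //; left.
split.
- move=> x; exists setT; split => //; first exact: openT.
  rewrite nuE; elim: r {nuE finY eqnu} => [|i r IHr]; rewrite ?big_nil ?big_cons//.
  by rewrite lte_add_pinfty// diracT mule1 ltry.
- move=> A mA; apply/eqP; rewrite eq_le; apply/andP; split.
    apply: le_ereal_inf_tmp => _ [U [oU AU] <-]; apply: le_measure; rewrite ?inE//.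
    exact: open_borel.
  apply: ereal_inf_lbound.
  exists (~` (~` A `&` y @` [set i | List.In i r])).
    split; last by move=> x Ax [].
    apply: closed_openC; apply: (accessible_finite_set_closed.1 _).
      exact: hausdorff_accessible.
    exact: finY.
  apply: eqnu => i ir; split => [/= nA|Ax [//]].
  by apply: contrapT => nAy; apply: nA; split => //; exists i.
- move=> U oU; apply/eqP; rewrite eq_le; apply/andP; split; last first.
    apply: ge_ereal_sup => _ [L [cL LU] <-]; apply: le_measure; rewrite ?inE//.
      exact: compact_borel.
    exact: open_borel.
  apply: ereal_sup_ubound; exists (U `&` y @` [set i | List.In i r]).
    by split; [apply: finite_compact; exact: finY|move=> x []].
  by apply: eqnu => i ir; split => [[]//|Uy]; split => //; exists i.
Qed.

End weighted_diracs.

(** * Capacity bounds deduced from the weak-type inequality *)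

Section capacity.
Context {R : realType} {X Y : ptopologicalType}.
Hypotheses (hX : hausdorff_space X) (hY : hausdorff_space Y).
Variable G : X * Y -> \bar R.
Hypothesis G_ge0 : forall z, 0 <= G z.
Hypothesis lG : lower_semicontinuous G.
Variables (q C : R).
Hypotheses (q_gt0 : (0 < q)%R) (C_gt0 : (0 < C)%R).
Variable sigma : {measure set (borel X) -> \bar R}.
Hypothesis sigma_radon : radon sigma.
Hypothesis weak_type : forall nu : {measure set (borel Y) -> \bar R}, radon nu ->
  weak_Lnorm sigma q (potential G nu) <= C%:E * nu [set: Y].

(** Taking the level proportional to the total mass [W] cancels [W] in the weak-type inequality, so
    the bound is uniform in the weights and points. *)
Lemma potential_diracs_level (I : finType) (w : I -> R) (y : I -> Y) (t : R) :
  (forall i, (0 <= w i)%R) -> (0 < t)%R ->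
  let A := [set x | (t * \sum_i w i)%:E < \sum_i (w i)%:E * G (x, y i)] in
  open A /\ sigma A <= ((C / t) `^ q)%:E.
Proof.
move=> w0 t0 A; set W := (\sum_i w i)%R.
have W0 : (0 <= W)%R by apply: sumr_ge0.
have [nu [nuE nuI]] := weighted_diracs y (index_enum I) w0.
have rnu := radon_weighted_diracs hY nuE.
have nuT : nu setT = W%:E.
  by rewrite nuE -sumEFin; apply: eq_bigr => i _; rewrite diracT mule1.
have potE x : potential G nu x = \sum_i (w i)%:E * G (x, y i).
  apply: nuI => //.
  exact: (@lsc_borel R Y (fun y => G (x, y)) (lsc_sectionr lG)).
have AE : A = [set x | (t * W)%:E < potential G nu x].
  by apply/seteqP; split => x /=; rewrite potE.
have oA : open A.
  rewrite AE; apply: open_potential_gt => //; first by rewrite nuT ltry.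
  by rewrite mulr_ge0// ltW.
(* For [W = 0] there is nothing to divide by, but then all weights vanish and [A] is empty. *)
split => //; move: W0; rewrite le_eqVlt => /orP[/eqP W0|W0].
  have wi0 i : w i = 0%R.
    by apply/eqP; move/esym/eqP: W0; rewrite psumr_eq0// => /allP/(_ i)/=; apply; rewrite mem_index_enum.
  rewrite (_ : A = set0) ?measure0 ?lee_fin ?powR_ge0//.
  rewrite -subset0 => x; rewrite /A/= -/W -W0 mulr0 big1 ?ltxx// => i _.
  by rewrite wi0 mul0e.
have tW0 : (0 < t * W)%R by rewrite mulr_gt0.
have := weak_type rnu; rewrite nuT => weak.
have : (t * W)%:E * sigma A `^ q^-1 <= C%:E * W%:E.
  apply: le_trans weak; apply: ereal_sup_ubound; exists (t * W)%R => //=.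
  congr (_ * sigma _ `^ _); rewrite AE; apply/seteqP.
  by split=> x /=; rewrite gee0_abs// potE; apply: sume_ge0 => i _; rewrite mule_ge0 ?lee_fin.
rewrite -EFinM -lee_pdivlMl// -EFinM => le1.
have -> : sigma A = (sigma A `^ q^-1) `^ q.
  by rewrite -poweRrM mulVf ?gt_eqF// poweRe1.
rewrite -poweR_EFin; apply: le_poweR; [exact: ltW|exact: poweR_ge0|].
apply: le_trans le1 _; rewrite lee_fin.
have tN0 : t != 0%R by rewrite gt_eqF.
have WN0 : W != 0%R by rewrite gt_eqF.
clearbody W; rewrite le_eqVlt; apply/orP; left; apply/eqP; field.
by rewrite tN0 WN0.
Qed.

Lemma cap0_lower_bound (K : set X) (a t : R) : compact K ->
  sigma K = a%:E -> (0 < a)%R -> (C / a `^ q^-1 < t)%R ->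
  (t^-1)%:E <= cap0 G K.
Proof.
move=> cK Ka a0; set th := (C / a `^ q^-1)%R => tht.
have mK : measurable (K : set (borel X)) by exact: compact_borel.
have th0 : (0 < th)%R by rewrite divr_gt0// powR_gt0.
(* The midpoint leaves room on both sides: [th < t0] makes [del] positive, [t0 < t] feeds the
   minimax lemma. *)
pose t0 := ((th + t) / 2)%R.
have [tht0 t0t] : (th < t0)%R /\ (t0 < t)%R.
  by split; rewrite midf_lt.
have t00 : (0 < t0)%R by exact: lt_trans tht0.
have tp : (0 < t)%R by exact: lt_trans t0t.
pose del := (a - (C / t0) `^ q)%R.
have del0 : (0 < del)%R.
  rewrite subr_gt0; have <- : ((a `^ q^-1) `^ q = a)%R.
    by rewrite -powRrM mulVf ?gt_eqF// powRr1// ltW.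
  apply: gt0_ltr_powR => //; rewrite ?nnegrE ?powR_ge0//.
    by rewrite divr_ge0// ltW.
  by rewrite ltr_pdivrMr// mulrC -ltr_pdivrMr// powR_gt0.
have del0' : (0 <= del^-1)%R by rewrite invr_ge0 ltW.
(* [m] dominates every normalized restriction of [sigma] to a subset of [K] of measure at least
   [del]. *)
pose m : {measure set (borel X) -> \bar R} := mscale (NngNum del0') (mrestr sigma mK).
have mE A : m A = (del^-1)%:E * sigma (A `&` K) by [].
have m_fin : m setT < +oo by rewrite mE setTI Ka -EFinM ltry.
(* Adjoint potentials are suprema of integrals of these simple minorants, so bounding the latter by
   [t] is enough. *)
pose S := [set s : {nnsfun borel X >-> R} | exists y, forall x, (s x)%:E <= G (x, y)].
have [I s w Ss w0|mu [mum mu1 mus]] := dominated_minimax m_fin (S := S) t0t.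
  have [y sG] := choice Ss.
  have [oA sA] := potential_diracs_level y w0 t00.
  set A := [set x | _] in oA sA.
  have mA := open_borel oA.
  (* What remains of [K] has [sigma]-measure at least [del], and on it the weighted sum of kernels
     is at most [t0] times the total weight. *)
  pose E : set (borel X) := K `\` A.
  have mE' : measurable E by exact: measurableD.
  have EK : E `<=` K by move=> x [].
  have Efin : sigma E \is a fin_num.
    rewrite ge0_fin_numE//; apply: (@le_lt_trans _ _ (sigma K)); last by rewrite Ka ltry.
    by apply: le_measure; rewrite ?inE.
  pose e := fine (sigma E); have eE : sigma E = e%:E by rewrite fineK.
  have dele : (del <= e)%R.
    rewrite /del lerBlDr -lee_fin EFinD -eE -Ka (measureDI sigma mK mA).
    rewrite leeD2l//; apply: le_trans sA; apply: le_measure; rewrite ?inE//.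
    exact: measurableI.
  have e0 : (0 < e)%R by exact: lt_le_trans dele.
  have e0' : (0 <= e^-1)%R by rewrite invr_ge0 ltW.
  pose mu : {measure set (borel X) -> \bar R} := mscale (NngNum e0') (mrestr sigma mE').
  have muE B : mu B = (e^-1)%:E * sigma (B `&` E) by [].
  have mu1 : mu setT = 1 by rewrite muE setTI eE -EFinM mulVf// gt_eqF.
  have muCE : mu (~` E) = 0 by rewrite muE setICl measure0 mule0.
  exists mu; split => //.
    move=> B mB; rewrite muE mE; apply: lee_pmul => //.
      by rewrite lee_fin lef_pV2.
    apply: le_measure; rewrite ?inE; [exact: measurableI|exact: measurableI|].
    by apply: setIS.
  have ms i : measurable_fun setT (EFin \o s i) by exact/measurable_EFinP.
  pose f x := \sum_i (w i)%:E * (s i x)%:E.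
  have mf : measurable_fun setT f.
    by apply: emeasurable_sum => i; exact: (measurable_funeM _ (ms i)).
  have f0 x : 0 <= f x.
    by apply: sume_ge0 => i _; rewrite mule_ge0// lee_fin.
  have -> : \sum_i (w i)%:E * \int[mu]_x (s i x)%:E = \int[mu]_x f x.
    rewrite ge0_integral_sum//.
    - apply: eq_bigr => i _; rewrite ge0_integralZl_EFin//; last exact: ms.
      by move=> x _; rewrite lee_fin.
    - by move=> i; exact: (measurable_funeM _ (ms i)).
    - by move=> i x _; rewrite mule_ge0// lee_fin.
  rewrite (ge0_integral_setID mu mf f0 measurableT mE') setTI setTD.
  rewrite (null_set_integral _ _ muCE) ?adde0; [|exact: measurableC|exact: measurable_funTS].
  apply: (@le_trans _ _ (\int[mu]_(x in E) (cst (t0 * \sum_i w i)%:E x))).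
    apply: ge0_le_integral => //; first exact: measurable_funTS.
    move=> x [Kx /negP]; rewrite -leNgt /= => nA; apply: le_trans nA.
    by apply: lee_sum => i _; rewrite lee_wpmul2l ?lee_fin.
  by rewrite integral_cst// muE setIid eE -!EFinM mulVf ?gt_eqF// mulr1.
have tV0 : (0 <= t^-1)%R by rewrite invr_ge0 ltW.
pose mu' : {measure set (borel X) -> \bar R} := mscale (NngNum tV0) mu.
have mu'E B : mu' B = (t^-1)%:E * mu B by [].
have muCK : mu (~` K) = 0.
  apply/eqP; rewrite eq_le measure_ge0 andbT.
  apply: (le_trans (mum _ (measurableC mK))).
  by rewrite mE setICl measure0 mule0.
have muK : mu K = 1.
  have := measureU mu mK (measurableC mK) (setICr K).
  by rewrite setUv [LHS]mu1 [X in (_ + X)%R]muCK addr0 => <-.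
have <- : mu' K = (t^-1)%:E by rewrite mu'E muK mule1.
apply: ereal_sup_ubound; exists mu' => //; split.
- apply: (radon_dominated hX sigma_radon cK (M := (t^-1 * del^-1)%R)).
    by rewrite mulr_ge0.
  move=> B mB; rewrite mu'E EFinM -muleA lee_wpmul2l ?lee_fin//.
  exact: mum.
- by rewrite /supported_in mu'E muCK mule0.
- move=> y; rewrite /adjoint_potential ge0_integral_mscale//; last first.
    exact: (@lsc_borel R X (fun x => G (x, y)) (lsc_sectionl lG)).
  rewrite lee_pdivrMl// mule1 ge0_integralTE//.
  apply: ge_ereal_sup => _ [s sG <-]; rewrite -integralT_nnsfun.
  by apply: mus; exists y.
Qed.

Lemma capacity_of_weak_type (K : set X) : compact K ->
  sigma K <= (C `^ q)%:E * (cap0 G K) `^ q.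
Proof.
move=> cK; have Kfin := radon_compact_lty hX sigma_radon cK.
have capK0 := cap0_ge0 G K.
have : sigma K = (fine (sigma K))%:E by rewrite fineK// ge0_fin_numE.
set a := fine _ => Ka.
have : (0 <= a)%R by rewrite fine_ge0.
rewrite le_eqVlt => /orP[/eqP a0|a0].
  by rewrite Ka -a0 mule_ge0 ?poweR_ge0// lee_fin powR_ge0.
set th := (C / a `^ q^-1)%R.
have b0 : (0 < a `^ q^-1)%R by rewrite powR_gt0.
have th0 : (0 < th)%R by rewrite divr_gt0.
have thcap : (th^-1)%:E <= cap0 G K.
  (* The lower bound is known only for [t > th]; it is applied at [t = th / r] for every [r] in
     [(0, 1)]. *)
  apply/lee_mul01Pr; first by rewrite lee_fin invr_ge0 ltW.
  move=> r /andP[r0 r1]; rewrite -EFinM -[(r * _)%R]invrK invfM invrK.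
  apply: cap0_lower_bound Ka a0 _ => //.
  by rewrite -/th mulrC ltr_pdivlMr// gtr_pMr.
rewrite -poweR_EFin -poweRM ?lee_fin ?(ltW C_gt0)//.
have -> : sigma K = (a `^ q^-1)%:E `^ q.
  by rewrite poweR_EFin -powRrM mulVf ?gt_eqF// powRr1// ltW.
apply: le_poweR; [exact: ltW|by rewrite lee_fin ltW|].
rewrite muleC -lee_pdivrMr//; apply: le_trans thcap.
by rewrite -EFinM lee_fin /th invf_div.
Qed.

End capacity.

Theorem proposition6p1 (R : realType) (X Y : ptopologicalType)
    (hausX : hausdorff_space X) (lcX : locally_compact [set: X])
    (hausY : hausdorff_space Y) (lcY : locally_compact [set: Y])
    (G : X * Y -> \bar R)
    (G_ge0 : forall z : X * Y, 0 <= G z)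
    (G_lsc : lower_semicontinuous G)
    (q : R) (q_gt0 : (0 < q)%R)
    (sigma : {measure set (borel X) -> \bar R}) (sigma_radon : radon sigma)
    (C : R) (C_gt0 : (0 < C)%R) :
  (forall nu : {measure set (borel Y) -> \bar R}, radon nu ->
     weak_Lnorm sigma q (potential G nu) <= C%:E * nu [set: Y])
  <->
  (forall K : set X, compact K ->
     sigma K <= (C `^ q)%:E * (cap0 G K) `^ q).
Proof.
split=> [weak K|]; first exact: capacity_of_weak_type.
exact: weak_type_of_capacity.
Qed.
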